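(* Let $\boldsymbol{X}=(\boldsymbol{X}_1,\dots,\boldsymbol{X}_{n_x})$ and $\boldsymbol{Y}=(\boldsymbol{Y}_1,\dots,\boldsymbol{Y}_{n_y})$ be two given samples, let $\mathbf{t}$ be the $\mathbb{R}^k$-valued sufficient statistic, and put $\bar{\boldsymbol{t}}^x=\frac{1}{n_x}\sum_{i=1}^{n_x}\mathbf{t}(\boldsymbol{X}_i)$, $\boldsymbol{t}^y_j=\mathbf{t}(\boldsymbol{Y}_j)$ for $j=1,\dots,n_y$, and $\boldsymbol{C}^y=\operatorname{conv}(\{\boldsymbol{t}^y_1,\dots,\boldsymbol{t}^y_{n_y}\})\subset\mathbb{R}^k$. Fix a norm $\Vert\cdot\Vert_{\ddagger}$ on $\mathbb{R}^k$ and $\lambda\ge 0$, and define the penalized empirical KLIEP loss on $\mathbb{R}^k$ by $$\ell_{\mathrm{KL};\lambda,\Vert\cdot\Vert_{\ddagger}}(\boldsymbol{\Delta})=-\boldsymbol{\Delta}^{\top}\bar{\boldsymbol{t}}^{x}+\log\left(\frac{1}{n_y}\sum_{j=1}^{n_y}\exp\{\boldsymbol{\Delta}^{\top}\boldsymbol{t}^{y}_j\}\right)+\lambda\Vert\boldsymbol{\Delta}\Vert_{\ddagger}.$$ Let $\Vert\cdot\Vert_{\#}$ be the norm dual to $\Vert\cdot\Vert_{\ddagger}$ and let $$\lambda^{\#}=\min_{\boldsymbol{t}\in\boldsymbol{C}^{y}}\Vert\bar{\boldsymbol{t}}^{x}-\boldsymbol{t}\Vert_{\#}$$ be the $\Vert\cdot\Vert_{\#}$-distance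 from $\bar{\boldsymbol{t}}^x$ to $\boldsymbol{C}^y$. Then: (i) if $\bar{\boldsymbol{t}}^{x}\in\operatorname{relint}(\boldsymbol{C}^{y})$, then $\ell_{\mathrm{KL};\lambda,\Vert\cdot\Vert_{\ddagger}}$ attains a global minimum for all $\lambda\ge 0$; (ii) if $\bar{\boldsymbol{t}}^{x}\in\operatorname{relbd}(\boldsymbol{C}^{y})$, then $\ell_{\mathrm{KL};\lambda,\Vert\cdot\Vert_{\ddagger}}$ attains a global minimum for all $\lambda>0$; if $\lambda=0$, then $\ell_{\mathrm{KL};\lambda,\Vert\cdot\Vert_{\ddagger}}$ is bounded from below but does not attain a global minimum; (iii) if $\bar{\boldsymbol{t}}^{x}\notin\boldsymbol{C}^{y}$, then (a) if $\lambda>\lambda^{\#}$, then $\ell_{\mathrm{KL};\lambda,\Vert\cdot\Vert_{\ddagger}}$ attains a global minimum; (b) if $\lambda=\lambda^{\#}$, then $\ell_{\mathrm{KL};\lambda,\Vert\cdot\Vert_{\ddagger}}$ is bounded from below; (c) if $\lambda<\lambda^{\#}$, then $\ell_{\mathrm{KL};\lambda,\Vert\cdot\Vert_{\ddagger}}$ is unbounded from below.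
   Context: The samples consist of $n_x\ge 1$ and $n_y\ge 1$ data points, treated as fixed (the result is deterministic, for given data). The map $\mathbf{t}=(t_1,\dots,t_k)^\top$ is the $k$-dimensional sufficient statistic of an exponential family with densities $f(\boldsymbol{x};\boldsymbol{\theta})=Z(\boldsymbol{\theta})^{-1}\exp\{\sum_{v=1}^k\theta_v t_v(\boldsymbol{x})\}$; the loss depends on the data only through $\bar{\boldsymbol{t}}^x\in\mathbb{R}^k$ and $\boldsymbol{t}^y_1,\dots,\boldsymbol{t}^y_{n_y}\in\mathbb{R}^k$. For a convex set $S\subseteq\mathbb{R}^k$, $\operatorname{relint}(S)$ denotes its relative interior (interior relative to its affine hull) and $\operatorname{relbd}(S)$ its relative boundary; for the compact polytope $\boldsymbol{C}^y$, $\operatorname{relbd}(\boldsymbol{C}^y)=\boldsymbol{C}^y\setminus\operatorname{relint}(\boldsymbol{C}^y)$. $\operatorname{conv}$ denotes the convex hull. The dual norm is $\Vert\boldsymbol{s}\Vert_{\#}=\max\{\boldsymbol{\Delta}^\top\boldsymbol{s}:\boldsymbol{\Delta}\in\mathbb{R}^k,\ \Vert\boldsymbol{\Delta}\Vert_{\ddagger}\le 1\}$. *)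

(* Defs.v *)
From HB Require Import structures.
From mathcomp Require Import all_boot all_order all_algebra.
From mathcomp Require Import all_classical all_reals all_analysis.

Set Implicit Arguments.
Unset Strict Implicit.
Unset Printing Implicit Defensive.

Import Order.TTheory GRing.Theory Num.Theory.
Import numFieldNormedType.Exports.

Local Open Scope classical_set_scope.
Local Open Scope ring_scope.

Definition dot (R : realType) (k : nat) (u v : 'rV[R]_k) : R :=
  \sum_(i < k) u 0 i * v 0 i.

(* Nonnegativity and [N 0 = 0] follow from these three axioms. *)
Record is_norm (R : realType) (k : nat) (N : 'rV[R]_k -> R) : Prop := IsNorm {
  norm_triangle : forall u v, N (u + v) <= N u + N v ;
  norm_scale : forall (a : R) u, N (a *: u) = `|a| * N u ;
  norm_definite : forall u, N u = 0 -> u = 0 }.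

(* The supremum is a maximum whenever [N] is a norm: see [dual_norm_max]. *)
Definition dual_norm (R : realType) (k : nat) (N : 'rV[R]_k -> R)
    (s : 'rV[R]_k) : R :=
  sup [set dot D s | D in [set D | N D <= 1]].

Definition conv_hull (R : realType) (k : nat) (S : set 'rV[R]_k) :
    set 'rV[R]_k :=
  [set x | exists (m : nat) (a : 'I_m -> R) (p : 'I_m -> 'rV[R]_k),
    [/\ forall i, S (p i), forall i, 0 <= a i, \sum_(i < m) a i = 1
      & x = \sum_(i < m) a i *: p i]].

Definition aff_hull (R : realType) (k : nat) (S : set 'rV[R]_k) :
    set 'rV[R]_k :=
  [set x | exists (m : nat) (a : 'I_m -> R) (p : 'I_m -> 'rV[R]_k),
    [/\ forall i, S (p i), \sum_(i < m) a i = 1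
      & x = \sum_(i < m) a i *: p i]].

(* [within A (nbhs x)] is the trace on [A] of the neighborhoods of [x]. *)
Definition relint (R : realType) (k : nat) (S : set 'rV[R]_k) :
    set 'rV[R]_k :=
  [set x | S x /\ within (aff_hull S) (nbhs x) S].

Definition relbd (R : realType) (k : nat) (S : set 'rV[R]_k) :
    set 'rV[R]_k :=
  closure S `\` relint S.

Definition sample_mean (R : realType) (k n : nat) (T : Type)
    (t : T -> 'rV[R]_k) (X : 'I_n -> T) : 'rV[R]_k :=
  n%:R^-1 *: \sum_(i < n) t (X i).

Definition sample_polytope (R : realType) (k n : nat) (T : Type)
    (t : T -> 'rV[R]_k) (Y : 'I_n -> T) : set 'rV[R]_k :=
  conv_hull (range (fun j => t (Y j))).

Definition kliep_loss (R : realType) (k nx ny : nat) (T : Type)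
    (t : T -> 'rV[R]_k) (X : 'I_nx -> T) (Y : 'I_ny -> T)
    (N : 'rV[R]_k -> R) (lambda : R) (D : 'rV[R]_k) : R :=
  - dot D (sample_mean t X)
  + ln (ny%:R^-1 * \sum_(j < ny) expR (dot D (t (Y j))))
  + lambda * N D.

(* The infimum is a minimum whenever [N] is a norm and [0 < ny]: see
   [lambda_dual_min]. *)
Definition lambda_dual (R : realType) (k nx ny : nat) (T : Type)
    (t : T -> 'rV[R]_k) (X : 'I_nx -> T) (Y : 'I_ny -> T)
    (N : 'rV[R]_k -> R) : R :=
  inf [set dual_norm N (sample_mean t X - c) | c in sample_polytope t Y].

Definition attains_global_min (R : realType) (k : nat)
    (f : 'rV[R]_k -> R) : Prop :=
  exists D0, forall D, f D0 <= f D.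

Definition bounded_below (R : realType) (k : nat) (f : 'rV[R]_k -> R) : Prop :=
  has_lbound (range f).

Section attainment.
Variables (R : realType) (k : nat).
Implicit Types (u v s : 'rV[R]_k) (N : 'rV[R]_k -> R).

Lemma dotDl u v s : dot (u + v) s = dot u s + dot v s.
Proof.
by rewrite /dot -big_split /=; apply: eq_bigr => i _; rewrite mxE mulrDl.
Qed.

Lemma dotDr u v s : dot s (u + v) = dot s u + dot s v.
Proof.
by rewrite /dot -big_split /=; apply: eq_bigr => i _; rewrite mxE mulrDr.
Qed.

Lemma dotZl a u s : dot (a *: u) s = a * dot u s.
Proof. by rewrite /dot mulr_sumr; apply: eq_bigr => i _; rewrite mxE mulrA. Qed.

Lemma dotZr a u s : dot s (a *: u) = a * dot s u.
Proof. by rewrite /dot mulr_sumr; apply: eq_bigr => i _; rewrite mxE mulrCA. Qed.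

Lemma coord_le (n : nat) (x : 'rV[R]_n) i : `|x 0 i| <= `|x|.
Proof.
rewrite [leRHS]/Num.norm /= mx_normrE.
exact: (le_bigmax _ (fun ij : 'I_1 * 'I_n => `|x ij.1 ij.2|) (0, i)).
Qed.

Lemma dot_le u s : `|dot u s| <= (\sum_(i < k) `|s 0 i|) * `|u|.
Proof.
rewrite /dot mulr_suml (le_trans (ler_norm_sum _ _ _))//.
by apply: ler_sum => i _; rewrite normrM mulrC ler_wpM2l// coord_le.
Qed.

Lemma lipschitz_continuous_rV (n : nat) (f : 'rV[R]_n -> R) (M : R) :
  (forall x y, `|f x - f y| <= M * `|x - y|) -> continuous f.
Proof.
move=> fM x; apply/(@cvgrPdist_le _ _ _ (nbhs x) (nbhs_filter x)) => e e0.
have M0 : 0 < `|M| + 1 by rewrite ltr_wpDl.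
have /(@cvgrPdist_le _ _ _ (nbhs x) (nbhs_filter x))/(_ (e / (`|M| + 1)) (divr_gt0 e0 M0)) := @cvg_id _ (nbhs x).
apply: filterS => y xy; rewrite (le_trans (fM x y))//.
apply: (@le_trans _ _ ((`|M| + 1) * `|x - y|)).
  by rewrite ler_wpM2r// (le_trans (ler_norm M))// lerDl.
by rewrite mulrC -ler_pdivlMr.
Qed.

Section norm_facts.
Variables (N : 'rV[R]_k -> R) (hN : is_norm N).

Lemma isnorm0 : N 0 = 0.
Proof. by rewrite -(scale0r 0) (norm_scale hN) normr0 mul0r. Qed.

Lemma isnormN u : N (- u) = N u.
Proof. by rewrite -scaleN1r (norm_scale hN) normrN1 mul1r. Qed.

Lemma isnorm_ge0 u : 0 <= N u.
Proof.
have := norm_triangle hN u (- u).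
by rewrite subrr isnorm0 isnormN -mulr2n pmulrn_lge0.
Qed.

Lemma isnorm_upper u : N u <= (\sum_(i < k) N (delta_mx 0 i)) * `|u|.
Proof.
have sumN (I : Type) (r : seq I) (F : I -> 'rV[R]_k) :
    N (\sum_(i <- r) F i) <= \sum_(i <- r) N (F i).
  elim: r => [|i r IH]; first by rewrite !big_nil isnorm0.
  by rewrite !big_cons (le_trans (norm_triangle hN _ _))// lerD2l.
rewrite {1}[u]row_sum_delta (le_trans (sumN _ _ _))// mulr_suml.
apply: ler_sum => i _; rewrite (norm_scale hN) mulrC.
by rewrite ler_wpM2l ?isnorm_ge0// coord_le.
Qed.

Lemma isnorm_dist u v : `|N u - N v| <= N (u - v).
Proof.
have h a b : N a - N b <= N (a - b).
  by rewrite lerBlDr (le_trans _ (norm_triangle hN _ _))// subrK.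
by rewrite ler_norml h andbT -isnormN opprB lerNl opprB h.
Qed.

Lemma isnorm_continuous : continuous N.
Proof.
apply: lipschitz_continuous_rV => u v.
exact: le_trans (isnorm_dist u v) (isnorm_upper _).
Qed.

Lemma isnorm_lower : exists2 c : R, 0 < c & forall u, c * `|u| <= N u.
Proof.
pose S := [set u : 'rV[R]_k | `|u| = 1].
have [S0|/set0P/negP/negPn/eqP S0] := pselect (S !=set0); last first.
  exists 1 => // u; rewrite mul1r.
  have [->|u0] := eqVneq u 0; first by rewrite normr0 isnorm_ge0.
  have : S (`|u|^-1 *: u).
    by rewrite /S /= normrZ normfV normr_id mulVf// normr_eq0.
  by rewrite S0.
have cS : compact S.
  apply: bounded_closed_compact.
    exists 1; split; first exact: num_real; move=> M M1 u /= ->; exact: ltW.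
  have -> : S = (fun u : 'rV[R]_k => `|u|) @^-1` [set 1] by [].
  by apply: closed_comp => [u _|]; [exact: norm_continuous|exact: closed_eq].
have cN : {within S, continuous N}.
  exact/continuous_subspaceT/isnorm_continuous.
have [c cS1 Nc] := compact_EVT_min S0 cS cN.
rewrite inE /S /= in cS1.
exists (N c).
  rewrite lt_neqAle isnorm_ge0 andbT eq_sym; apply/eqP => /(norm_definite hN) c0.
  by move/eqP: cS1; rewrite c0 normr0 eq_sym oner_eq0.
move=> u; have [->|u0] := eqVneq u 0; first by rewrite normr0 mulr0 isnorm_ge0.
have u0' : 0 < `|u| by rewrite normr_gt0.
rewrite -ler_pdivlMr//.
have := Nc (`|u|^-1 *: u); rewrite (norm_scale hN) normfV normr_id mulrC.
by apply; rewrite inE /S /= normrZ normfV normr_id mulVf// gt_eqF.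
Qed.

Lemma dual_norm_max s :
  (exists2 D, N D <= 1 & dot D s = dual_norm N s) /\
  (forall D, N D <= 1 -> dot D s <= dual_norm N s).
Proof.
pose B := [set D : 'rV[R]_k | N D <= 1].
have B0 : B !=set0 by exists 0; rewrite /B /= isnorm0.
have [c c0 Nc] := isnorm_lower.
have cB : compact B.
  apply: bounded_closed_compact.
    exists c^-1; split; first exact: num_real; move=> M M1 u /= Bu.
    rewrite (le_trans _ (ltW M1))// -[leRHS]mul1r ler_pdivlMr// mulrC.
    exact: le_trans (Nc u) Bu.
  have -> : B = N @^-1` [set x | x <= 1] by [].
  apply: closed_comp => [u _|]; [exact: isnorm_continuous|exact: closed_le].
have cd : {within B, continuous (fun D => dot D s)}.
  apply: continuous_subspaceT; apply: lipschitz_continuous_rV => u v.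
  by rewrite -mulN1r -dotZl -dotDl scaleN1r; exact: dot_le.
have [D DB Dmax] := compact_EVT_max B0 cB cd.
rewrite inE in DB.
have ub : ubound [set dot D s | D in B] (dot D s).
  by move=> _ [E BE <-]; apply: Dmax; rewrite inE.
have max E : N E <= 1 -> dot E s <= dual_norm N s.
  move=> NE; apply: ub_le_sup; first by exists (dot D s).
  by exists E.
split=> //; exists D => //; apply/eqP; rewrite eq_le max//=.
by apply: ge_sup => //; exists (dot D s), D.
Qed.

Lemma dual_norm_dist u v :
  `|dual_norm N u - dual_norm N v| <= dual_norm N (u - v).
Proof.
have h a b : dual_norm N a - dual_norm N b <= dual_norm N (a - b).
  have [[D D1 <-] _] := dual_norm_max a.
  rewrite lerBlDr -{1}(subrK b a) dotDr lerD//.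
    exact: (dual_norm_max _).2.
  exact: (dual_norm_max _).2.
have hN' a : dual_norm N (- a) <= dual_norm N a.
  have [[D D1 <-] _] := dual_norm_max (- a).
  rewrite -scaleN1r dotZr -dotZl; apply: (dual_norm_max _).2.
  by rewrite scaleN1r isnormN.
rewrite ler_norml h andbT lerNl opprB (le_trans (h _ _))//.
by rewrite -opprB.
Qed.

Lemma dual_norm_upper :
  exists M : R, forall s, dual_norm N s <= M * `|s|.
Proof.
have [c c0 Nc] := isnorm_lower.
exists (k%:R * c^-1) => s; have [[D D1 <-] _] := dual_norm_max s.
have Dc : `|D| <= c^-1.
  by rewrite -[leRHS]mul1r ler_pdivlMr// mulrC (le_trans (Nc D)).
rewrite (le_trans (ler_norm _))// (le_trans (dot_le _ _))// mulrAC.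
apply: ler_pM => //; first exact: sumr_ge0.
apply: (@le_trans _ _ (\sum_(i < k) `|s|)).
  by apply: ler_sum => i _; exact: coord_le.
by rewrite sumr_const card_ord mulr_natl.
Qed.

End norm_facts.

Lemma conv_hull_range (n : nat) (p : 'I_n -> 'rV[R]_k) :
  conv_hull (range p) =
  [set \sum_(j < n) b 0 j *: p j |
     b in [set b : 'rV[R]_n | (forall j, 0 <= b 0 j) /\ \sum_j b 0 j = 1]].
Proof.
apply/seteqP; split=> [x [m [a [q [qp a0 a1 ->]]]]|_ [b [b0 b1] <-]]; last first.
  by exists n, (b 0), p; split=> // i; exists i.
have /choice[f fq] : forall i, exists j, p j = q i.
  by move=> i; have [j _ <-] := qp i; exists j.
exists (\row_j \sum_(i < m | f i == j) a i).
  split=> [j|]; first by rewrite mxE sumr_ge0.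
  rewrite -a1 [RHS](partition_big f predT)//=.
  by apply: eq_bigr => j _; rewrite mxE.
rewrite [RHS](partition_big f predT)//=.
apply: eq_bigr => j _; rewrite mxE scaler_suml.
by apply: eq_bigr => i /eqP <-; rewrite fq.
Qed.

Lemma lambda_dual_min (nx ny : nat) (T : Type) (t : T -> 'rV[R]_k)
    (X : 'I_nx -> T) (Y : 'I_ny -> T) (N : 'rV[R]_k -> R) :
  is_norm N -> (0 < ny)%N ->
  (exists2 c, sample_polytope t Y c &
     dual_norm N (sample_mean t X - c) = lambda_dual t X Y N) /\
  (forall c, sample_polytope t Y c ->
     lambda_dual t X Y N <= dual_norm N (sample_mean t X - c)).
Proof.
move=> hN ny0.
pose W := [set b : 'rV[R]_ny | (forall j, 0 <= b 0 j) /\ \sum_j b 0 j = 1].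
pose L (b : 'rV[R]_ny) : 'rV[R]_k := \sum_(j < ny) b 0 j *: t (Y j).
pose f b := dual_norm N (sample_mean t X - L b).
have PE : sample_polytope t Y = L @` W by exact: conv_hull_range.
have W0 : W !=set0.
  exists (delta_mx 0 (Ordinal ny0)); split=> [j|].
    by rewrite mxE ler0n.
  rewrite (bigD1 (Ordinal ny0))//= big1 => [|j jn]; rewrite !mxE !eqxx ?addr0//=.
  by rewrite (negPf jn).
have coordc j : continuous (fun b : 'rV[R]_ny => b 0 j).
  by move=> b; exact: coord_continuous.
have cW : compact W.
  apply: bounded_closed_compact.
    exists 1; split; first exact: num_real; move=> M M1 b /= [b0 b1].
    rewrite (le_trans _ (ltW M1))// [leLHS]/Num.norm /= mx_normrE.
    apply: bigmax_le => // -[i j] _ /=; rewrite ord1 ger0_norm//.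
    by rewrite -b1 (bigD1 j)//= lerDl sumr_ge0.
  pose A := \bigcap_(j in [set: 'I_ny]) [set b : 'rV[R]_ny | 0 <= b 0 j].
  pose B := [set b : 'rV[R]_ny | \sum_j b 0 j = 1].
  have -> : W = A `&` B.
    apply/seteqP; split=> b [b0 b1]; split=> // j; first by move=> _; apply: b0.
    exact: b0.
  apply: closedI.
    apply: closed_bigI => j _.
    apply: (@closed_comp _ _ (fun b : 'rV[R]_ny => b 0 j) [set x | 0 <= x]).
      by move=> b _; exact: coordc.
    exact: closed_ge.
  apply: (@closed_comp _ _ (fun b : 'rV[R]_ny => \sum_j b 0 j) [set 1]);
    last exact: closed_eq.
  move=> b _.
  apply: (@lipschitz_continuous_rV _ _ ny%:R) => u v.
  rewrite -sumrB (le_trans (ler_norm_sum _ _ _))//.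
  apply: (@le_trans _ _ (\sum_(j < ny) `|u - v|)).
    apply: ler_sum => j _.
    have -> : u 0 j - v 0 j = (u - v) 0 j by rewrite !mxE.
    exact: coord_le.
  by rewrite sumr_const card_ord mulr_natl.
have [M HM] := dual_norm_upper hN.
pose K := \sum_(j < ny) `|t (Y j)|.
have LK (u v : 'rV[R]_ny) : `|L u - L v| <= K * `|u - v|.
  rewrite /L -sumrB (le_trans (ler_norm_sum _ _ _))// /K mulr_suml.
  apply: ler_sum => j _; rewrite -scalerBl normrZ mulrC ler_wpM2l//.
  have -> : u 0 j - v 0 j = (u - v) 0 j by rewrite !mxE.
  exact: coord_le.
have cf : {within W, continuous f}.
  apply: continuous_subspaceT.
  apply: (@lipschitz_continuous_rV _ _ (`|M| * K)) => u v.
  rewrite /f (le_trans (dual_norm_dist hN _ _))// (le_trans (HM _))//.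
  have -> : sample_mean t X - L u - (sample_mean t X - L v) = - (L u - L v).
    by rewrite !opprB addrC addrA subrK.
  by rewrite normrN (le_trans (ler_wpM2r _ (ler_norm M)))// -mulrA ler_wpM2l.
have [b bW bmin] := compact_EVT_min W0 cW cf.
rewrite inE in bW.
have lb : lbound [set dual_norm N (sample_mean t X - c) | c in sample_polytope t Y]
                 (f b).
  by rewrite PE => _ [_ [d Wd <-] <-]; apply: bmin; rewrite inE.
have min c : sample_polytope t Y c ->
    lambda_dual t X Y N <= dual_norm N (sample_mean t X - c).
  by move=> Pc; apply: ge_inf; [exists (f b)|exists c].
have Lb : sample_polytope t Y (L b) by rewrite PE; exists b.
split=> //; exists (L b) => //; apply/eqP; rewrite eq_le min// andbT.
by apply: lb_le_inf => //; exists (f b), (L b).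
Qed.

End attainment.

(* Main.v *)
Require Import Defs.
From mathcomp Require Import all_boot all_order all_algebra.
From mathcomp Require Import all_classical all_reals all_analysis.
From mathcomp Require Import ring lra.

Import Order.TTheory GRing.Theory Num.Theory.
Import numFieldNormedType.Exports.
Local Open Scope classical_set_scope.
Local Open Scope ring_scope.

(** Write [p_j] for the points [t (Y j)], [m] for the mean of the [x]-sample,
[P] for the convex hull of the [p_j], [N] for the norm and [L] for the
distance [lambda_dual] from [m] to [P].  Up to the penalty, the loss is
[lme (scores D)], where [lme a] is the logarithm of the mean of the
[expR a_j] and [scores D] is the vector of the numbers [dot D (p_j - m)]
([lossE]).

Lower bound.  Since [lme a] is at least every convex combination of the [a_j]
minus [ln ny], pairing [D] with a nearest point of [P] gives
[(lambda - L) * N D - ln ny <= loss lambda D] ([loss_ge]).  So the loss is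
bounded below when [L <= lambda], and it is coercive, hence attains its
minimum, when [L < lambda].  If [m] is in the closure of [P] then [L <= 0],
which settles boundedness and all positive [lambda] in that case.

First-order condition.  At a minimizer [D0], the softmax weights of
[scores D0] are positive and define a point [c] of [P] with
[dot E (m - c) <= lambda * N E] for every [E] ([loss_first_order]).  It
replaces any separation theorem:

- for [lambda = 0] it gives [m = c], a convex combination of all the [p_j]
  with positive weights, so [m] is in the relative interior of [P]
  ([positive_relint], [min_loss0_relint]); hence there is no minimum on the
  relative boundary;
- in general it says that [m - c] has dual norm at most [lambda], so
  [L <= lambda] ([lambda_dual_le_of_min]).  If the loss were bounded below for
  some [lambda < L], then it would be coercive for a parameter strictly
  between [lambda] and [L] and attain its minimum there, a contradiction
  ([loss_unbounded]).

Relative interior, [lambda = 0].  Here [m] is a convex combination of all the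
[p_j] with positive weights ([relint_positive]), so the vectors [scores D] are
orthogonal to a positive weight vector.  On such vectors [lme] is coercive
([lme_coercive]), and the scores form a closed linear subspace on which [lme]
therefore attains its minimum ([relint_loss0_attains]). *)

(** * Coercive minimization, linear maps and dual norms *)

Section toolbox.
Set Implicit Arguments.
Unset Strict Implicit.
Variable R : realType.

Lemma coercive_attains_min (n : nat) (S : set 'rV[R]_n) (f : 'rV[R]_n -> R)
    (c b : R) :
  closed S -> S !=set0 -> continuous f -> 0 < c ->
  (forall x, S x -> c * `|x| - b <= f x) ->
  exists2 x, S x & forall y, S y -> f x <= f y.
Proof.
move=> cS [x0 Sx0] cf c0 fc.
pose r := Num.max `|x0| ((f x0 + b) / c).
pose K := S `&` [set x | `|x| <= r].
have K0 : K !=set0 by exists x0; split => //=; rewrite /r le_max lexx.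
have cK : compact K.
  apply: bounded_closed_compact.
    exists r; split; first exact: num_real.
    by move=> M rM u [_ /= ur]; exact: le_trans ur (ltW rM).
  apply: closedI => //.
  apply: (@preimage_closed _ _ (fun u : 'rV[R]_n => `|u|) [set x | x <= r]).
    by move=> u _; exact: norm_continuous.
  exact: closed_le.
have [x Kx xmin] := compact_EVT_min K0 cK (continuous_subspaceT cf).
rewrite inE in Kx; exists x; first by case: Kx.
move=> y Sy; have [yr|ry] := leP `|y| r; first by apply: xmin; rewrite inE.
apply: (@le_trans _ _ (f x0)).
  by apply: xmin; rewrite inE; split => //=; rewrite /r le_max lexx.
apply: le_trans (fc y Sy); rewrite lerBrDr -ler_pdivrMl//.
by apply: le_trans (ltW ry); rewrite /r le_max mulrC lexx orbT.
Qed.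

Lemma mulmxr_le (n q : nat) (B : 'M[R]_(n, q)) (a : 'rV[R]_n) :
  `|a *m B| <= (\sum_j \sum_i `|B i j|) * `|a|.
Proof.
rewrite [leLHS]/Num.norm /= mx_normrE.
apply: bigmax_le => [|[i j] _ /=].
  by rewrite mulr_ge0// sumr_ge0// => j _; exact: sumr_ge0.
rewrite ord1 mxE (le_trans (ler_norm_sum _ _ _))// mulr_suml.
rewrite (bigD1 j)//= -[leLHS]addr0 lerD//.
  rewrite mulr_suml; apply: ler_sum => l _.
  by rewrite normrM mulrC ler_wpM2l// coord_le.
by apply: sumr_ge0 => l _; rewrite mulr_ge0// sumr_ge0.
Qed.

Lemma closed_mulmxr_ker (n q : nat) (B : 'M[R]_(n, q)) :
  closed [set a : 'rV[R]_n | a *m B = 0].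
Proof.
have -> : [set a : 'rV[R]_n | a *m B = 0] =
    (fun a : 'rV[R]_n => `|a *m B|) @^-1` [set 0].
  apply/seteqP; split=> a /= => [->|/eqP]; first by rewrite normr0.
  by rewrite normr_eq0 => /eqP.
apply: preimage_closed => [a _|]; last exact: closed_eq.
move: a; apply: lipschitz_continuous_rV => a b.
apply: le_trans (ler_dist_dist _ _) _.
by rewrite -mulmxBl; exact: mulmxr_le.
Qed.

(** A second-order upper bound, from [expR x <= (1 - x)^-1]. *)
Lemma expR_sub1_le (x : R) : x <= 2^-1 -> expR x - 1 <= x + 2 * x ^+ 2.
Proof.
move=> x2; have h1 := expR_ge1Dx (- x); have h2 := expRxMexpNx_1 x.
have h3 := expR_gt0 x.
have h4 : expR x * (1 - x) <= 1 by rewrite -[leRHS]h2 ler_pM2l.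
have h5 : 0 < 1 - x by lra.
have h6 : 0 <= x ^+ 2 * (1 - 2 * x) by rewrite mulr_ge0 ?sqr_ge0//; lra.
by rewrite -(ler_pM2r h5); lra.
Qed.

Lemma dotBr (k : nat) (s u v : 'rV[R]_k) : dot s (u - v) = dot s u - dot s v.
Proof. by rewrite dotDr -scaleN1r dotZr mulN1r. Qed.

Lemma dot_sumr (k : nat) (I : Type) (r : seq I) (D : 'rV[R]_k)
    (F : I -> 'rV[R]_k) :
  dot D (\sum_(i <- r) F i) = \sum_(i <- r) dot D (F i).
Proof.
elim: r => [|i r IH]; last by rewrite !big_cons dotDr IH.
by rewrite !big_nil /dot big1// => i _; rewrite mxE mulr0.
Qed.

Lemma norm_dot_le (k : nat) (N : 'rV[R]_k -> R) (hN : is_norm N) D s :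
  dot D s <= N D * dual_norm N s.
Proof.
have [D0|D0] := eqVneq (N D) 0.
  rewrite D0 mul0r (norm_definite hN D0) /dot big1// => i _.
  by rewrite mxE mul0r.
have Dp : 0 < N D by rewrite lt_neqAle eq_sym D0 isnorm_ge0.
have := (dual_norm_max hN s).2 ((N D)^-1 *: D).
rewrite (norm_scale hN) gtr0_norm ?invr_gt0// mulVf// dotZl ler_pdivrMl//.
exact.
Qed.

Lemma dual_norm_le (k : nat) (N : 'rV[R]_k -> R) (hN : is_norm N) s (l : R) :
  0 <= l -> (forall D, dot D s <= l * N D) -> dual_norm N s <= l.
Proof.
move=> l0 h; have [[D D1 <-] _] := dual_norm_max hN s.
by rewrite (le_trans (h D))// ler_piMr.
Qed.

End toolbox.

(** * The logarithm of the mean of exponentials *)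

Section log_mean_exp.
Set Implicit Arguments.
Unset Strict Implicit.
Variables (R : realType) (n : nat).
Implicit Types a b : 'rV[R]_n.

(** The logarithm of the arithmetic mean of the exponentials of the entries. *)
Definition lme a : R := ln (n%:R^-1 * \sum_(j < n) expR (a 0 j)).

Hypothesis n0 : (0 < n)%N.

Lemma sum_expR_gt0 a : 0 < \sum_(j < n) expR (a 0 j).
Proof.
rewrite (bigD1 (Ordinal n0))//= ltr_pwDl ?expR_gt0//.
by apply: sumr_ge0 => j _; exact: expR_ge0.
Qed.

Lemma expR_lme a : expR (lme a) = n%:R^-1 * \sum_(j < n) expR (a 0 j).
Proof.
by rewrite /lme lnK// posrE mulr_gt0 ?sum_expR_gt0// invr_gt0 ltr0n.
Qed.

Lemma coord_le_lme a j : a 0 j <= lme a + ln n%:R.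
Proof.
have np : 0 < n%:R :> R by rewrite ltr0n.
rewrite -ler_expR expRD expR_lme lnK// mulrAC mulVf ?gt_eqF// mul1r.
by rewrite (bigD1 j)//= lerDl; apply: sumr_ge0 => i _; exact: expR_ge0.
Qed.

Lemma convex_le_lme a (w : 'I_n -> R) :
  (forall j, 0 <= w j) -> \sum_j w j = 1 ->
  \sum_j w j * a 0 j <= lme a + ln n%:R.
Proof.
move=> w0 w1; rewrite -[leRHS]mul1r -[X in _ <= X * _]w1 mulr_suml.
by apply: ler_sum => j _; rewrite ler_wpM2l// coord_le_lme.
Qed.

Lemma lme_le a b : lme a <= lme b + `|a - b|.
Proof.
rewrite -ler_expR expRD !expR_lme -mulrA ler_wpM2l ?invr_ge0//.
rewrite mulr_suml; apply: ler_sum => j _; rewrite -expRD ler_expR.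
have := coord_le (a - b) j; rewrite !mxE => /(le_trans (ler_norm _)).
by rewrite lerBlDl.
Qed.

Lemma lme_dist a b : `|lme a - lme b| <= `|a - b|.
Proof.
by rewrite ler_norml lerBlDl lme_le andbT lerNl opprB lerBlDl distrC lme_le.
Qed.

Lemma lme_continuous : continuous lme.
Proof.
apply: (@lipschitz_continuous_rV _ _ _ 1) => a b.
by rewrite mul1r lme_dist.
Qed.

(** The gradient of [lme] at [a]: a vector of positive weights with sum [1]. *)
Definition softmax a (j : 'I_n) : R := expR (a 0 j) / \sum_(i < n) expR (a 0 i).

Lemma softmax_gt0 a j : 0 < softmax a j.
Proof. by rewrite divr_gt0 ?expR_gt0 ?sum_expR_gt0. Qed.

Lemma sum_softmax a : \sum_j softmax a j = 1.
Proof. by rewrite -mulr_suml mulfV// gt_eqF// sum_expR_gt0. Qed.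

(** This is [ln y <= y - 1], where [y] is the softmax average of the
[expR (b 0 j)]. *)
Lemma lme_sub_le a b :
  lme (a + b) - lme a <= \sum_j softmax a j * (expR (b 0 j) - 1).
Proof.
under eq_bigr do rewrite mulrBr mulr1; rewrite sumrB sum_softmax.
set s := \sum_j _.
suff sE : s = expR (lme (a + b) - lme a).
  by rewrite lerBrDr addrC sE expR_ge1Dx.
rewrite expRB !expR_lme /s /softmax; under eq_bigr do rewrite mulrAC -expRD.
rewrite -mulr_suml -mulf_div divff ?mul1r ?invr_neq0 ?pnatr_eq0 -?lt0n//.
by congr (_ / _); apply: eq_bigr => j _; rewrite mxE.
Qed.

(** On the vectors orthogonal to a fixed positive weight vector, [lme] grows at
least linearly: the largest entry of such a vector controls its norm. *)
Lemma lme_coercive a (w : 'I_n -> R) (c : R) :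
  0 < c -> (forall j, c <= w j) -> \sum_j w j = 1 ->
  \sum_j w j * a 0 j = 0 -> c * `|a| <= lme a + ln n%:R.
Proof.
move=> c0 cw w1 wa; set L := lme a + ln n%:R.
have w0 j : 0 <= w j by rewrite (le_trans (ltW c0)).
have aL j : a 0 j <= L by exact: coord_le_lme.
have L0 : 0 <= L by rewrite -wa; exact: convex_le_lme.
have wj1 j : w j <= 1 by rewrite -w1 (bigD1 j)//= lerDl sumr_ge0.
have LE : \sum_i w i * (L - a 0 i) = L.
  under eq_bigr do rewrite mulrBr.
  by rewrite sumrB wa subr0 -mulr_suml w1 mul1r.
have waL j : w j * (L - a 0 j) <= L.
  rewrite -[leRHS]LE (bigD1 j)//= lerDl sumr_ge0// => i _.
  by rewrite mulr_ge0// subr_ge0.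
have caL j : c * `|a 0 j| <= L.
  have := (w0 j, wj1 j, cw j, waL j, aL j) => -[[[[+ +] +] +] +].
  by case: (lerP 0 (a 0 j)) => [/ger0_norm|/ltr0_norm] ->; nra.
rewrite mulrC -ler_pdivlMr// [leLHS]/Num.norm /= mx_normrE.
apply: bigmax_le => [|[i j] _ /=]; first by rewrite divr_ge0// ltW.
by rewrite ord1 ler_pdivlMr// mulrC.
Qed.

(** If moving from [a] by [e *: b] at cost [e * q] is never profitable, then the
derivative of [lme] at [a] along [b] is at least [- q]. *)
Lemma lme_first_order a b (q : R) :
  (forall e : R, 0 < e -> lme a <= lme (a + e *: b) + e * q) ->
  0 <= \sum_j softmax a j * b 0 j + q.
Proof.
move=> h; rewrite leNgt; apply/negP => s0; set s := (X in X < 0) in s0.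
(* [M] keeps the entries of [e *: b] below [1 / 2], as [expR_sub1_le] needs;
   [C] makes the second-order error smaller than the first-order decrease. *)
pose M := 2 * `|b| + 1.
have M0 : 0 < M by rewrite ltr_wpDl// mulr_ge0.
pose C := 2 * `|b| ^+ 2 + 1.
have C0 : 0 < C by rewrite ltr_wpDl// mulr_ge0// sqr_ge0.
pose e := Num.min M^-1 (- s / C / 2).
have e0 : 0 < e.
  by rewrite lt_min invr_gt0 M0/= !divr_gt0// oppr_gt0.
have eM : e * M <= 1 by rewrite -ler_pdivlMr// mul1r /e ge_min lexx.
have eC : e * C <= - s / 2.
  by rewrite -ler_pdivlMr// mulrAC /e ge_min lexx orbT.
have key : \sum_j softmax a j * (expR ((e *: b) 0 j) - 1) <=
    e * (s - q) + 2 * e ^+ 2 * `|b| ^+ 2.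
  have -> : e * (s - q) + 2 * e ^+ 2 * `|b| ^+ 2 =
      \sum_j softmax a j * (e * b 0 j + 2 * e ^+ 2 * `|b| ^+ 2).
    under [RHS]eq_bigr do rewrite mulrDr mulrCA.
    by rewrite big_split/= -mulr_suml -mulr_sumr sum_softmax mul1r /s addrK.
  apply: ler_sum => j _.
  apply: ler_wpM2l; first by rewrite ltW// softmax_gt0.
  rewrite mxE; have bj := coord_le b j.
  have [bj1 bj2] : b 0 j <= `|b| /\ - `|b| <= b 0 j.
    by split; move: bj; rewrite ler_norml => /andP[].
  apply: (le_trans (expR_sub1_le _)); first by rewrite /M in eM; nra.
  have bj3 : b 0 j ^+ 2 <= `|b| ^+ 2 by rewrite !expr2; nra.
  rewrite lerD2l exprMn -mulrA; apply: ler_wpM2l => //.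
  by apply: ler_wpM2l => //; exact: sqr_ge0.
have := le_trans (lme_sub_le a (e *: b)) key.
have := h e e0.
rewrite /C in eC; nra.
Qed.

End log_mean_exp.

(** * Relative interior of the convex hull of finitely many points *)

Section polytope.
Set Implicit Arguments.
Unset Strict Implicit.
Variables (R : realType) (k n : nat) (p : 'I_n -> 'rV[R]_k) (m : 'rV[R]_k).

(** The matrix whose rows are the vectors [p j - m]. *)
Definition spokes : 'M[R]_(n, k) := \matrix_(j, i) (p j - m) 0 i.

Lemma sum_spokes (d : 'rV[R]_n) :
  d *m spokes = \sum_j d 0 j *: (p j - m).
Proof.
rewrite mulmx_sum_row; apply: eq_bigr => j _; congr (_ *: _).
by apply/rowP => i; rewrite !mxE.
Qed.

Lemma sum_spokes_affine (d : 'I_n -> R) : \sum_j d j = 1 ->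
  \sum_j d j *: (p j - m) = \sum_j d j *: p j - m.
Proof.
move=> d1; under eq_bigr do rewrite scalerBr.
by rewrite sumrB -scaler_suml d1 scale1r.
Qed.

Lemma aff_hull_conv_spokes (x : 'rV[R]_k) :
  aff_hull (conv_hull (range p)) x -> (x - m <= spokes)%MS.
Proof.
move=> [l [a [q [qP a1 ->]]]].
have -> : \sum_i a i *: q i - m = \sum_i a i *: (q i - m).
  under [RHS]eq_bigr do rewrite scalerBr.
  by rewrite sumrB -scaler_suml a1 scale1r.
apply: summx_sub => i _; apply: scalemx_sub.
have := qP i; rewrite conv_hull_range => -[b [_ b1] <-].
by rewrite -sum_spokes_affine// -sum_spokes submxMl.
Qed.

(** A point [x] of the affine hull close to [m] has [x - m] in the row space of
[spokes]; the coefficients given by the pseudo-inverse are small, so correcting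
the positive weights [w] by them keeps the weights nonnegative. *)
Lemma positive_relint (w : 'I_n -> R) :
  (forall j, 0 < w j) -> \sum_j w j = 1 -> m = \sum_j w j *: p j ->
  relint (conv_hull (range p)) m.
Proof.
move=> w0 w1 mE; split.
  by exists n, w, p; split => // j; exact: ltW.
pose e (x : 'rV[R]_k) := (x - m) *m pinvmx spokes.
(* The factor [1 - \sum_i e x 0 i] makes these weights sum to [1]. *)
pose b (x : 'rV[R]_k) j := w j * (1 - \sum_i e x 0 i) + e x 0 j.
have e_m : e m = 0 by rewrite /e subrr mul0mx.
have b_m j : b m j = w j.
  by rewrite /b e_m mxE big1 ?subr0 ?mulr1 ?addr0// => i _; rewrite mxE.
have bc j : continuous (b ^~ j).
  pose M := \sum_j \sum_i `|pinvmx spokes i j|.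
  apply: (@lipschitz_continuous_rV _ _ _ (w j * n%:R * M + M)) => x y.
  have exy : `|e x - e y| <= M * `|x - y|.
    have -> : e x - e y = (x - y) *m pinvmx spokes.
      by rewrite /e -mulmxBl opprB addrA subrK.
    exact: mulmxr_le.
  have eixy i : `|e x 0 i - e y 0 i| <= M * `|x - y|.
    have -> : e x 0 i - e y 0 i = (e x - e y) 0 i by rewrite !mxE.
    exact: le_trans (coord_le _ _) exy.
  have -> : b x j - b y j =
      w j * (- (\sum_i (e x 0 i - e y 0 i))) + (e x 0 j - e y 0 j).
    by rewrite /b sumrB; ring.
  rewrite (le_trans (ler_normD _ _))// mulrDl lerD//.
  rewrite normrM normrN gtr0_norm// -!mulrA; apply: ler_wpM2l; first exact: ltW.
  rewrite (le_trans (ler_norm_sum _ _ _))//.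
  apply: (@le_trans _ _ (\sum_(i < n) M * `|x - y|)).
    by apply: ler_sum => i _; exact: eixy.
  by rewrite sumr_const card_ord mulr_natl.
have nb : \forall x \near nbhs m, forall j, 0 <= b x j.
  apply: filter_forall => j.
  have bm : b x j @[x --> m] --> b m j by exact: bc.
  by apply: (@cvgr_ge _ _ _ (nbhs_filter m) _ _ bm); rewrite b_m.
rewrite /within /=; apply: filterS nb => x xb xaff.
have eQ : e x *m spokes = x - m by rewrite mulmxKpV// aff_hull_conv_spokes.
have b1 : \sum_j b x j = 1.
  by rewrite big_split/= -mulr_suml w1 mul1r subrK.
exists n, (b x), p; split => //.
apply/eqP; rewrite -(inj_eq (addIr (- m))) -sum_spokes_affine//; apply/eqP.
under eq_bigr do rewrite scalerDl mulrC -scalerA.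
rewrite big_split/= -sum_spokes eQ -scaler_sumr sum_spokes_affine// -mE.
by rewrite subrr scaler0 add0r.
Qed.

(** The segment from the barycenter [q] of the points to [m] can be prolonged a
little beyond [m] inside the polytope; [m] is then a convex combination of a
point of the polytope and of [q], with a positive coefficient at [q], so that it
inherits positive weights from [q]. *)
Lemma relint_positive : (0 < n)%N -> relint (conv_hull (range p)) m ->
  exists (w : 'I_n -> R) (c : R),
    [/\ 0 < c, forall j, c <= w j, \sum_j w j = 1 & m = \sum_j w j *: p j].
Proof.
move=> n0 [Pm nPm].
have np : n%:R != 0 :> R by rewrite pnatr_eq0 -lt0n.
pose q := \sum_j n%:R^-1 *: p j.
have un : \sum_(j < n) n%:R^-1 = 1 :> R.
  by rewrite sumr_const card_ord -[LHS]mulr_natl mulfV.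
have Pq : conv_hull (range p) q.
  by exists n, (fun=> n%:R^-1), p; split => // j; rewrite invr_ge0.
have aff e : aff_hull (conv_hull (range p)) (m + e *: (m - q)).
  exists 2%N, (fun i => if i == ord0 then 1 + e else - e),
    (fun i => if i == ord0 then m else q); split.
  - by move=> i; case: ifP.
  - by rewrite !big_ord_recl big_ord0 /=; ring.
  - rewrite !big_ord_recl big_ord0 /= addr0 scalerDl scale1r scalerBr scaleNr.
    by rewrite addrA.
have [e e0 Pe] : exists2 e, 0 < e & conv_hull (range p) (m + e *: (m - q)).
  move: nPm; rewrite /within /= => /nbhs_ballP[d /= d0 dP].
  have M0 : 0 < `|m - q| + 1 by rewrite ltr_wpDl.
  exists (d / 2 / (`|m - q| + 1)); first by rewrite !divr_gt0.
  apply: dP => //; rewrite -ball_normE /= opprD addrA subrr add0r normrN normrZ.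
  rewrite gtr0_norm ?divr_gt0// mulrAC ltr_pdivrMr//.
  have := normr_ge0 (m - q); nra.
move: Pe; rewrite conv_hull_range => -[b [b0 b1] bE].
have e1 : 1 + e != 0 by rewrite gt_eqF// ltr_wpDl.
have e1p : 0 < 1 + e by rewrite ltr_wpDl.
exists (fun j => (1 + e)^-1 * (b 0 j + e / n%:R)), ((1 + e)^-1 * (e / n%:R)).
split.
- by rewrite mulr_gt0 ?invr_gt0// divr_gt0// ltr0n.
- by move=> j; apply: ler_wpM2l; rewrite ?lerDr// invr_ge0 ltW.
- rewrite -mulr_sumr big_split/= b1 -mulr_sumr un; field; exact: e1.
- under eq_bigr do rewrite -scalerA scalerDl -(scalerA e).
  rewrite -scaler_sumr big_split/= bE -scaler_sumr -/q scalerBr addrA subrK.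
  have -> : m + e *: m = (1 + e) *: m by rewrite scalerDl scale1r.
  by rewrite scalerA mulVf// scale1r.
Qed.

End polytope.

(** * Bounds and minimizers of the loss *)

Section kliep.
Set Implicit Arguments.
Unset Strict Implicit.
Variables (R : realType) (k nx ny : nat) (T : Type) (t : T -> 'rV[R]_k).
Variables (X : 'I_nx -> T) (Y : 'I_ny -> T) (N : 'rV[R]_k -> R).
Hypotheses (ny0 : (0 < ny)%N) (hN : is_norm N).

Let tx := sample_mean t X.
Let p j := t (Y j).
Let loss := kliep_loss t X Y N.
Let lambdas := lambda_dual t X Y N.

(** The vector of the inner products [dot D (p j - tx)]; see [scoresE]. *)
Definition scores (D : 'rV[R]_k) : 'rV[R]_ny := D *m (spokes p tx)^T.

Lemma scoresE D j : scores D 0 j = dot D (p j - tx).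
Proof. by rewrite mxE; apply: eq_bigr => i _; rewrite !mxE. Qed.

Lemma dot_sum_scores D (w : 'I_ny -> R) : \sum_j w j = 1 ->
  \sum_j w j * scores D 0 j = dot D (\sum_j w j *: p j - tx).
Proof.
move=> w1; rewrite -sum_spokes_affine// dot_sumr; apply: eq_bigr => j _.
by rewrite scoresE dotZr.
Qed.

Lemma lossE lambda D : loss lambda D = lme (scores D) + lambda * N D.
Proof.
congr (_ + _); rewrite /lme.
under [in RHS]eq_bigr do rewrite scoresE dotBr addrC expRD.
have n0 : 0 < ny%:R^-1 :> R by rewrite invr_gt0 ltr0n.
have S0 : 0 < \sum_j expR (dot D (p j)).
  have := sum_expR_gt0 ny0 (\row_j dot D (p j)).
  by under eq_bigr do rewrite mxE.
by rewrite -mulr_sumr mulrCA [RHS]lnM ?posrE ?expR_gt0 ?mulr_gt0// expRK.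
Qed.

Lemma loss_continuous lambda : continuous (loss lambda).
Proof.
pose M := \sum_j \sum_i `|(spokes p tx)^T i j|.
pose K := \sum_(i < k) N (delta_mx 0 i).
apply: (@lipschitz_continuous_rV _ _ _ (M + `|lambda| * K)) => D E.
rewrite !lossE opprD addrACA (le_trans (ler_normD _ _))// mulrDl lerD//.
  rewrite (le_trans (lme_dist ny0 _ _))// -mulmxBl; exact: mulmxr_le.
rewrite -mulrBr normrM -mulrA ler_wpM2l//.
exact: le_trans (isnorm_dist hN _ _) (isnorm_upper hN _).
Qed.

(** Hoelder's inequality at a point of the polytope nearest to [tx]. *)
Lemma lme_scores_ge D : - (lambdas * N D) <= lme (scores D) + ln ny%:R.
Proof.
have [[c Pc cE] _] := lambda_dual_min t X Y hN ny0.
move: Pc; rewrite /sample_polytope conv_hull_range => -[b [b0 b1] bE].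
apply: le_trans (convex_le_lme ny0 (scores D) b0 b1).
rewrite dot_sum_scores// bE dotBr -opprB -dotBr lerN2.
by rewrite mulrC /lambdas -cE norm_dot_le.
Qed.

Lemma loss_ge lambda D : (lambda - lambdas) * N D - ln ny%:R <= loss lambda D.
Proof. by have := lme_scores_ge D; rewrite lossE; lra. Qed.

Lemma loss_growth_attains lambda (d b : R) : 0 < d ->
  (forall D, d * N D - b <= loss lambda D) -> attains_global_min (loss lambda).
Proof.
move=> d0 hd; have [c c0 cN] := isnorm_lower hN.
have [||||D|D _ Dmin] := @coercive_attains_min R k setT (loss lambda) (d * c) b.
- exact: closedT.
- by exists 0.
- exact: loss_continuous.
- exact: mulr_gt0.
- by move=> _; apply: le_trans (hd D); rewrite lerD2r -mulrA ler_wpM2l// ltW.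
by exists D => E; exact: Dmin.
Qed.

(** The point with softmax weights is [tx] plus the gradient of the unpenalized
loss at the minimizer [D0]. *)
Lemma loss_first_order (lambda : R) D0 : 0 <= lambda ->
  (forall D, loss lambda D0 <= loss lambda D) ->
  forall E, dot E (tx - \sum_j softmax (scores D0) j *: p j) <= lambda * N E.
Proof.
move=> l0 Dmin E.
have h (e : R) : 0 < e ->
    lme (scores D0) <= lme (scores D0 + e *: scores E) + e * (lambda * N E).
  move=> e0; have := Dmin (D0 + e *: E); rewrite !lossE.
  rewrite {2}/scores mulmxDl -scalemxAl -!/(scores _).
  have := norm_triangle hN D0 (e *: E).
  rewrite (norm_scale hN) gtr0_norm//.
  nra.
have := lme_first_order ny0 h; rewrite dot_sum_scores ?sum_softmax//.
by rewrite !dotBr; lra.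
Qed.

Lemma lambda_dual_le_of_min (lambda : R) : 0 <= lambda ->
  attains_global_min (loss lambda) -> lambdas <= lambda.
Proof.
move=> l0 [D0 Dmin].
have [_ lmin] := lambda_dual_min t X Y hN ny0.
apply: (le_trans (lmin (\sum_j softmax (scores D0) j *: p j) _)).
  exists ny, (softmax (scores D0)), p; split => //.
  - by move=> j; rewrite ltW// softmax_gt0.
  - exact: sum_softmax.
by apply: dual_norm_le => //; exact: loss_first_order.
Qed.

Lemma loss_unbounded (lambda : R) : 0 <= lambda -> lambda < lambdas ->
  ~ bounded_below (loss lambda).
Proof.
move=> l0 ll [B hB].
pose l' := (lambda + lambdas) / 2.
have [l1 l2] : lambda < l' /\ l' < lambdas by rewrite /l'; split; lra.
suff : lambdas <= l' by lra.
apply: lambda_dual_le_of_min; first lra.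
apply: (@loss_growth_attains _ (l' - lambda) (- B)); first lra.
move=> D; have := hB (loss lambda D) (ex_intro2 _ _ D I erefl).
by rewrite !lossE; lra.
Qed.

Lemma min_loss0_relint :
  attains_global_min (loss 0) -> relint (sample_polytope t Y) tx.
Proof.
move=> [D0 Dmin].
apply: (@positive_relint _ _ _ p tx (softmax (scores D0))).
- exact: softmax_gt0.
- exact: sum_softmax.
set c := \sum_j _; apply/eqP; rewrite -subr_eq0; apply/eqP/rowP => i.
(* Tested against [tx - c] itself, the condition bounds its squared length. *)
have := loss_first_order (lexx 0) Dmin (tx - c); rewrite mul0r -/c.
set v := tx - c => v0; rewrite [RHS]mxE; apply/eqP.
rewrite -sqrf_eq0 eq_le sqr_ge0 andbT; apply: le_trans v0.
rewrite /dot (bigD1 i)//= -expr2 lerDl; apply: sumr_ge0 => l _.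
by rewrite -expr2 sqr_ge0.
Qed.

Lemma lambda_dual_closure : closure (sample_polytope t Y) tx -> lambdas <= 0.
Proof.
move=> cl; rewrite leNgt; apply/negP => l0.
have [_ lmin] := lambda_dual_min t X Y hN ny0.
have [M hM] := dual_norm_upper hN.
have M0 : 0 < `|M| + 1 by rewrite ltr_wpDl.
have [c [Pc]] := cl _ (nbhsx_ballx tx _ (divr_gt0 l0 M0)).
rewrite -ball_normE /= ltr_pdivlMr// => cM.
have := le_trans (lmin c Pc) (hM _); have := ler_norm M.
have := normr_ge0 (tx - c); rewrite -/lambdas -/tx; nra.
Qed.

Lemma relint_loss0_attains :
  relint (sample_polytope t Y) tx -> attains_global_min (loss 0).
Proof.
move=> /(relint_positive ny0)[w [c [c0 cw w1 txE]]].
pose A := (spokes p tx)^T.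
(* [S] is the set of all score vectors, written as a kernel to see that it is
   closed. *)
pose S := [set a : 'rV[R]_ny | a *m cokermx A = 0].
have SE a : S a -> exists D, a = scores D.
  by move=> /= /eqP; rewrite -submxE => /submxP.
have [||||a|a Sa amin] :=
    @coercive_attains_min R ny S (@lme R ny) c (ln ny%:R).
- exact: closed_mulmxr_ker.
- by exists 0; rewrite /S /= mul0mx.
- exact: lme_continuous.
- by [].
- move=> /SE[D ->]; rewrite lerBlDr; apply: (lme_coercive ny0 c0 cw w1).
  rewrite dot_sum_scores// -txE subrr.
  by rewrite /dot big1// => i _; rewrite mxE mulr0.
have [D0 aE] := SE a Sa; exists D0 => D; rewrite !lossE !mul0r !addr0 -aE.
by apply: amin; rewrite /S /= /scores -/A -mulmxA mulmx_coker mulmx0.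
Qed.

End kliep.

Theorem theorem2 (R : realType) (k nx ny : nat) (hnx : (0 < nx)%N)
    (hny : (0 < ny)%N) (T : Type) (t : T -> 'rV[R]_k)
    (X : 'I_nx -> T) (Y : 'I_ny -> T)
    (N : 'rV[R]_k -> R) (hN : is_norm N) :
  let tx := sample_mean t X in
  let Cy := sample_polytope t Y in
  let loss (lambda : R) := kliep_loss t X Y N lambda in
  let lambdas := lambda_dual t X Y N in
  [/\ relint Cy tx ->
        forall lambda : R, 0 <= lambda -> attains_global_min (loss lambda),
      relbd Cy tx ->
        (forall lambda : R, 0 < lambda -> attains_global_min (loss lambda)) /\
        (bounded_below (loss 0) /\ ~ attains_global_min (loss 0))
    & ~ Cy tx ->
        forall lambda : R, 0 <= lambda ->
        [/\ lambdas < lambda -> attains_global_min (loss lambda),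
            lambda = lambdas -> bounded_below (loss lambda)
          & lambda < lambdas -> ~ bounded_below (loss lambda)]].
Proof.
move=> tx Cy loss lambdas.
have gt_attains lambda : lambdas < lambda -> attains_global_min (loss lambda).
  move=> ll; apply: (@loss_growth_attains _ _ _ _ _ t X Y N hny hN lambda
    (lambda - lambdas) (ln ny%:R)); first by rewrite subr_gt0.
  exact: loss_ge.
have ge_bounded lambda : lambdas <= lambda -> bounded_below (loss lambda).
  move=> ll; exists (- ln ny%:R) => _ [D _ <-].
  apply: le_trans (loss_ge t X Y hny hN lambda D).
  rewrite lerDr mulr_ge0 ?subr_ge0//.
  exact: isnorm_ge0.
split.
- move=> rtx lambda; rewrite le_eqVlt => /orP[/eqP <-|l0].
    exact: relint_loss0_attains.
  apply/gt_attains/le_lt_trans/l0/lambda_dual_closure => //.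
  by apply: subset_closure; case: rtx.
- move=> [ctx nrtx]; have l0 : lambdas <= 0 by exact: lambda_dual_closure.
  split => [lambda lp|]; first exact/gt_attains/(le_lt_trans l0).
  split; first exact: ge_bounded.
  by move=> /(min_loss0_relint hny hN).
- move=> _ lambda l0; split => [|->|]; [exact: gt_attains|exact: ge_bounded|].
  exact: loss_unbounded.
Qed.
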